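(* Let $G$ be a finite group with exponent $n_1=2^mp_1^{m_1}\cdots p_r^{m_r}$ ($p_i$ distinct odd primes) and conjugacy class scheme $\mathcal{A}$. Let $\Delta=2^{w_0}(-1)^w\prod_{k=1}^r\big((-1)^{(p_k-1)/2}p_k\big)^{w_k}$ with $w,w_0,\ldots,w_r\in\{0,1\}$, $w_0=0$ if $m<3$, $w=0$ if $m<2$, and let $H_\Delta=\{k\in\mathbb{Z}_{n_1}^*:\chi(k)^{w_0}\left(\frac k4\right)^w\prod_{j=1}^r\left(\frac k{p_j}\right)^{w_j}=1\}$. Define $g\sim_\Delta h$ iff $g$ is conjugate to $h^k$ for some $k\in H_\Delta$. Let $C_1,C_2\subseteq G$ be disjoint unions of conjugacy classes with $1\notin C_1\cup C_2$, and let $M=A_{C_1}-A_{C_2}$. Then: (i) all eigenvalues of $M$ lie in $\mathbb{Q}(\sqrt\Delta)$ iff $C_1$ and $C_2$ are both unions of equivalence classes of $\sim_\Delta$; (ii) all eigenvalues of $M$ are integer multiples of $\sqrt\Delta$ iff either $\Delta=1$ and $C_1,C_2$ are unions of $\sim_1$ classes, or $\Delta\ne1$, $C_1$ is a union of $\sim_\Delta$ classes, and $C_2=C_1^k:=\{g^k:g\in C_1\}$ for some $k\in\mathbb{Z}_{n_1}^*\setminus H_\Delta$. Furthermore, in case (ii) with $\Delta\neq 1$: if $\Delta<0$ then $M$ is the skew-symmetric adjacency matrix of an oriented normal Cayley graph, and if $\Delta>0$ then $M$ is the symmetric adjacency matrix of a signed normal Cayley graph.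
   Context: For a finite group $G$ (multiplicative, identity $1$), $A_g$ is the permutation matrix with $(A_g)_{a,b}=1$ iff $ba^{-1}=g$, and $A_C=\sum_{g\in C}A_g$. The conjugacy class scheme is $\{A_{K_0},\ldots,A_{K_d}\}$ for the conjugacy classes $K_i$. The exponent $n_1$ is the least positive integer with $g^{n_1}=1$ for all $g$; for $k\in\mathbb{Z}_{n_1}^*$, $g^k$ is well defined. $\left(\frac kp\right)$ is the Legendre symbol; for odd $k$, $\left(\frac k4\right)=\pm1$ according as $k\equiv\pm1\pmod 4$; $\chi(k)=1$ if $k\equiv\pm1\pmod 8$ and $-1$ if $k\equiv\pm3\pmod8$. A normal Cayley graph is one whose connection set(s) are unions of conjugacy classes. An oriented Cayley graph $X(G,C)$ ($C\cap C^{-1}=\emptyset$) has skew-symmetric adjacency matrix $A_C-A_C^T$; a signed Cayley graph $X(G,C(1),C(-1))$ with disjoint inverse-closed $C(\pm1)$ has adjacency matrix $A_{C(1)}-A_{C(-1)}$. *)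

(* Defs.v *)
From HB Require Import structures.
From mathcomp Require Import all_boot all_order all_algebra fingroup abelian algC.
Set Implicit Arguments. Unset Strict Implicit. Unset Printing Implicit Defensive.
Import Order.TTheory GRing.Theory Num.Theory.

Section Defs.
Variable gT : finGroupType.

Definition Amat (C : {set gT}) : 'M[algC]_#|gT| :=
  \matrix_(i, j) (((enum_val j * (enum_val i)^-1)%g \in C)%:R)%R.

Definition normal_set (C : {set gT}) : Prop :=
  forall x, x \in C -> (x ^: [set: gT])%g \subset C.

Definition set_pow (C : {set gT}) (k : nat) : {set gT} := [set (x ^+ k)%g | x in C].

End Defs.

Definition legendre (k p : nat) : int :=
  if k %% p == 0 then 0%R
  else if [exists x : 'I_p, (x * x) %% p == k %% p] then 1%R else (-1)%R.

Definition leg4 (k : nat) : int := if k %% 4 == 1 then 1%R else (-1)%R.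

Definition chi8 (k : nat) : int := if (k %% 8 == 1) || (k %% 8 == 7) then 1%R else (-1)%R.

(* Delta = 2^{w0} (-1)^w prod_{p in S} ((-1)^{(p-1)/2} p), S = primes p_k with w_k = 1 *)
Definition Delta (w0 w : bool) (S : seq nat) : int :=
  (2%:Z ^+ w0 * (-1) ^+ w * \prod_(p <- S) ((-1) ^+ (p.-1)./2 * p%:Z))%R.

Definition inH (w0 w : bool) (S : seq nat) (k : nat) : bool :=
  ((chi8 k) ^+ w0 * (leg4 k) ^+ w * \prod_(p <- S) legendre k p == 1)%R.

Definition simD (gT : finGroupType) (w0 w : bool) (S : seq nat) (g h : gT) : Prop :=
  exists k : nat, [/\ coprime k (exponent [set: gT]), inH w0 w S k &
                       g \in ((h ^+ k) ^: [set: gT])%g].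

Definition simD_closed (gT : finGroupType) (w0 w : bool) (S : seq nat)
  (C : {set gT}) : Prop :=
  forall g h : gT, simD w0 w S g h -> (g \in C) = (h \in C).

(* Main.v *)
(* The eigenvalues of the Cayley matrix of a class function f are the numbers
   lam_i = (sum_g f(g) chi_i(g)) / chi_i(1).  For k prime to the exponent n, the
   automorphism u_k of the n-th cyclotomic field maps chi_i(g) to chi_i(g^k), so
   for c = 1 or -1 the identity u_k(lam_i) = c lam_i for all i is equivalent to
   f(g^k) = c f(g) for all g.  By quadratic Gauss sums u_k acts on sqrt(Delta)
   by the quadratic character defining H_Delta; a cyclotomic number fixed by all
   the u_k is rational, and integrality in (ii) holds because the eigenvalues are
   algebraic integers and Delta is squarefree.  Complex conjugation is the case
   k = -1, which gives the oriented and signed cases. *)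
Require Import Defs.
From HB Require Import structures.
From mathcomp Require Import all_boot all_order all_algebra fingroup abelian algC.
From mathcomp Require Import cyclic cyclotomic algnum finfield.
From mathcomp Require Import mxrepresentation classfun character.
Set Implicit Arguments. Unset Strict Implicit. Unset Printing Implicit Defensive.
Import Order.TTheory GRing.Theory Num.Theory.
Local Open Scope ring_scope.

(** * Rationality in cyclotomic fields *)

Local Notation QtoC := (ratr : rat -> algC).
Local Notation pQtoC := (map_poly QtoC).

(** Membership in the field Q(z): as [z] is algebraic, values of rational polynomials at [z] already
    form a field, so no quotients occur. *)
Definition in_Qz (z x : algC) : Prop := exists P : {poly rat}, x = (pQtoC P).[z].

Lemma in_Qz_rat z (a : rat) : in_Qz z (ratr a).
Proof. by exists a%:P; rewrite map_polyC hornerC. Qed.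

Lemma in_QzD z x y : in_Qz z x -> in_Qz z y -> in_Qz z (x + y).
Proof. by move=> [P ->] [Q ->]; exists (P + Q); rewrite rmorphD hornerD. Qed.

Lemma in_QzM z x y : in_Qz z x -> in_Qz z y -> in_Qz z (x * y).
Proof. by move=> [P ->] [Q ->]; exists (P * Q); rewrite rmorphM hornerM. Qed.

Lemma in_Qz_int z (a : int) : in_Qz z a%:~R.
Proof. by rewrite -[a%:~R](ratr_int algC); apply: in_Qz_rat. Qed.

Lemma in_Qz_sum z (I : Type) (r : seq I) (P : pred I) (F : I -> algC) :
  (forall i, P i -> in_Qz z (F i)) -> in_Qz z (\sum_(i <- r | P i) F i).
Proof.
by move=> hF; apply: big_ind => //; [apply: (in_Qz_int z 0) | apply: in_QzD].
Qed.

Lemma in_Qz_unity n z x : n.-primitive_root z -> x ^+ n = 1 -> in_Qz z x.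
Proof.
move=> prim_z /(prim_rootP prim_z)[k ->]; exists 'X^k.
by rewrite map_polyXn hornerXn.
Qed.

(* The remainder of [P] modulo the [n]-th cyclotomic polynomial takes the value
   [x] at all primitive [n]-th roots of unity, so it is constant. *)
Lemma in_Qz_fixed_rat n z x :
    n.-primitive_root z -> in_Qz z x ->
    (forall k (u : {rmorphism algC -> algC}), coprime k n ->
       (forall y, y ^+ n = 1 -> u y = y ^+ k) -> u x = x) ->
  x \in Crat.
Proof.
move=> prim_z [P Dx] fix_x.
have n_gt0 := prim_order_gt0 prim_z.
have [m [Dm mon_m] dv_m] := minCpolyP z.
have Dc := minCpoly_cyclotomic prim_z.
pose Q := P %% m.
have Qzk k : coprime k n -> (pQtoC Q).[z ^+ k] = x.
  move=> co_k_n; have [u Du] := Qn_aut_exists co_k_n.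
  have <- : (pQtoC P).[z ^+ k] = x.
    rewrite -(fix_x k u co_k_n Du) Dx -horner_map -map_poly_comp.
    rewrite (Du _ (prim_expr_order prim_z)); congr (horner _ _).
    by apply: eq_map_poly => a /=; rewrite fmorph_rat.
  rewrite (divp_eq P m) -/Q rmorphD rmorphM hornerD hornerM /= -Dm Dc.
  have /rootP-> : root (cyclotomic z n) (z ^+ k).
    by rewrite (root_cyclotomic prim_z) prim_root_exp_coprime.
  by rewrite mulr0 add0r.
pose rs := [seq z ^+ (val i) | i : 'I_n in [pred i : 'I_n | coprime i n]].
have szm : size m = (totient n).+1.
  by rewrite -(size_map_poly QtoC) -Dm Dc size_cyclotomic.
(* The remainder has at most [totient n] coefficients, while [rs] lists [totient n] distinct roots
   of the difference. *)
have q0 : pQtoC Q - x%:P = 0.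
  apply: (@roots_geq_poly_eq0 _ _ rs).
  - apply/allP => _ /imageP[i /= co_i ->].
    by rewrite rootE hornerD hornerN hornerC Qzk // subrr.
  - rewrite map_inj_in_uniq ?enum_uniq // => i j _ _ /eqP.
    by rewrite (eq_prim_root_expr prim_z) !modn_small ?ltn_ord // => /eqP/val_inj.
  have -> : size rs = totient n.
    rewrite size_map -cardE totient_count_coprime big_mkord -sum1_card.
    rewrite [LHS]big_mkcond /=; apply: eq_bigr => i _.
    by rewrite unfold_in /= coprime_sym; case: (coprime n i).
  apply: leq_trans (size_polyD _ _) _.
  rewrite geq_max size_polyN size_map_poly size_polyC -ltnS -szm.
  rewrite ltn_modp monic_neq0 //=.
  by apply: leq_trans (leq_b1 _) _; rewrite totient_gt0.
have /eqP := congr1 (fun p : {poly algC} => p`_0) q0.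
rewrite /= coefB coef_map coefC coef0 /= subr_eq0 => /eqP <-.
exact: rpred_rat.
Qed.

(** * Quadratic Gauss sums *)

Section QuadraticCharacter.

Variable F : finFieldType.
Hypothesis oddF : odd #|F|.

Definition quad_char (a : F) : int :=
  if a == 0 then 0 else if [exists x, x * x == a] then 1 else -1.

Lemma finField_card_predK : (#|F|.-1).+1 = #|F|.
Proof. by rewrite prednK // (ltn_trans _ (finNzRing_gt1 F)). Qed.

Lemma finField_expf_pred (x : F) : x != 0 -> x ^+ #|F|.-1 = 1.
Proof.
by move=> x0; apply: (mulfI x0); rewrite -exprS finField_card_predK expf_card mulr1.
Qed.

Lemma finField_even_pred : ~~ odd #|F|.-1.
Proof. by rewrite -oddS finField_card_predK. Qed.

Lemma prim_root_neq0 (n : nat) (g : F) : n.-primitive_root g -> g != 0.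
Proof.
move=> gP; apply/eqP => g0; have /eqP := prim_expr_order gP.
by rewrite g0 expr0n gtn_eqF ?(prim_order_gt0 gP) // eq_sym oner_eq0.
Qed.

Lemma finField_prim_root : exists g : F, (#|F|.-1).-primitive_root g.
Proof.
have q_gt0 : (0 < #|F|.-1)%N by rewrite -subn1 subn_gt0 finNzRing_gt1.
have := @has_prim_root F (#|F|.-1) (enum (predC1 (0 : F))) q_gt0.
case/(_ _ (enum_uniq _) _)/hasP => [||g _ gP]; last by exists g.
  apply/allP => x; rewrite mem_enum !inE => x0; exact/unity_rootP/finField_expf_pred.
by rewrite -cardE cardC1.
Qed.

(** The order [#|F|.-1] of the generator [g] is even, so the parity of an exponent is well defined,
    and the nonzero squares are exactly the even powers of [g]. *)
Lemma quad_char_expr g j : (#|F|.-1).-primitive_root g ->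
  quad_char (g ^+ j) = (-1) ^+ j.
Proof.
move=> gP; have q_gt0 := prim_order_gt0 gP.
have g0 := prim_root_neq0 gP.
rewrite /quad_char expf_eq0 (negbTE g0) andbF.
have -> : [exists x, x * x == g ^+ j] = ~~ odd j; last first.
  by rewrite -signr_odd; case: (odd j).
apply/existsP/idP => [[x /eqP Dx]|ev_j].
  have [|i Di] := prim_rootP gP (_ : x ^+ #|F|.-1 = 1).
    apply: finField_expf_pred.
    by apply: contraNneq (expf_neq0 j g0) => x0; rewrite -Dx x0 mul0r.
  have /eqP := Dx; rewrite Di -exprD addnn (eq_prim_root_expr gP).
  have q_even : (2 %| #|F|.-1)%N by rewrite dvdn2 finField_even_pred.
  move/eqP/(congr1 (modn^~ 2)); rewrite !modn_dvdm // !modn2 odd_double.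
  by case: (odd j).
by exists (g ^+ j./2); rewrite -exprD addnn even_halfK.
Qed.

Lemma quad_charM a b : quad_char (a * b) = quad_char a * quad_char b.
Proof.
have [->|a0] := eqVneq a 0; first by rewrite mul0r /quad_char eqxx mul0r.
have [->|b0] := eqVneq b 0; first by rewrite mulr0 /quad_char eqxx mulr0.
have [g gP] := finField_prim_root.
have [i ->] := prim_rootP gP (finField_expf_pred a0); have [j ->] := prim_rootP gP (finField_expf_pred b0).
by rewrite -exprD !quad_char_expr // exprD.
Qed.

Lemma quad_char0 : quad_char 0 = 0. Proof. by rewrite /quad_char eqxx. Qed.

Lemma quad_char_sqr a : a != 0 -> quad_char a * quad_char a = 1.
Proof. by move=> a0; rewrite /quad_char (negbTE a0); case: ifP. Qed.

(** The power of a generator with exponent [(#|F|.-1)./2] squares to 1 but is not 1, hence it is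
    -1. *)
Lemma quad_charN1 : quad_char (-1) = (-1) ^+ (#|F|.-1)./2.
Proof.
have [g gP] := finField_prim_root; rewrite -(quad_char_expr _ gP); congr quad_char.
have q_even := finField_even_pred.
have : (g ^+ (#|F|.-1)./2) ^+ 2 == 1.
  by rewrite -exprM muln2 even_halfK // prim_expr_order.
rewrite sqrf_eq1 => /orP[|/eqP->//].
rewrite -(prim_order_dvd gP) => /dvdn_leq; have q_gt0 := prim_order_gt0 gP.
have h_gt0 : (0 < (#|F|.-1)./2)%N by rewrite half_gt0; case: (#|F|.-1) q_gt0 q_even => [|[]].
by move/(_ h_gt0); rewrite leqNgt -{2}(even_halfK q_even) -addnn -{1}[_./2]addn0 ltn_add2l h_gt0.
Qed.

(** Multiplication by a generator permutes the field and flips every sign, so the sum is its own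
    opposite. *)
Lemma sum_quad_char : \sum_a quad_char a = 0.
Proof.
have [g gP] := finField_prim_root.
have g0 := prim_root_neq0 gP.
have : \sum_a quad_char a = - \sum_a quad_char a.
  rewrite {1}(reindex_inj (mulfI g0)) /= -sumrN; apply: eq_bigr => a _.
  by rewrite quad_charM -[in quad_char g](expr1 g) quad_char_expr // expr1 mulN1r.
by move/eqP; rewrite -addr_eq0 -mulr2n mulrn_eq0 => /eqP.
Qed.

End QuadraticCharacter.

Lemma eqFp_nat p m n : prime p -> (m%:R == n%:R :> 'F_p) = (m == n %[mod p])%N.
Proof. by move=> p_pr; rewrite -val_eqE /= !val_Fp_nat. Qed.

Lemma legendre_quad_char k p : prime p -> legendre k p = quad_char (k%:R : 'F_p).
Proof.
move=> p_pr; rewrite /legendre /quad_char.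
rewrite -[0 in RHS]/(0%:R : 'F_p) eqFp_nat // mod0n; case: ifP => // _.
congr (if _ then _ else _); apply/existsP/existsP => [[x xP]|[x xP]].
  by exists (val x)%:R; rewrite -natrM eqFp_nat.
have xp : (val x < p)%N by rewrite -[X in (_ < X)%N]Fp_cast ?ltn_ord.
by exists (Ordinal xp); rewrite -eqFp_nat // natrM natr_Zp.
Qed.

(** * Gauss sums over the prime field *)

Section GaussSum.

Variables (p : nat) (w : algC).
Hypotheses (p_pr : prime p) (p_odd : odd p) (wP : p.-primitive_root w).

Definition add_char (a : 'F_p) : algC := w ^+ val a.

Definition gauss_sum : algC := \sum_a (quad_char a)%:~R * add_char a.

Let wp1 := prim_expr_order wP.

Lemma add_charD a b : add_char (a + b) = add_char a * add_char b.
Proof.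
rewrite /add_char -exprD -[RHS](prim_expr_mod wP); congr (w ^+ _).
by rewrite -val_Fp_nat // natrD !natr_Zp.
Qed.

Lemma add_charMn k a : add_char (k%:R * a) = add_char a ^+ k.
Proof.
rewrite /add_char -exprM -[RHS](prim_expr_mod wP); congr (w ^+ _).
by rewrite -val_Fp_nat // natrM natr_Zp mulrC.
Qed.

(** For nonzero [d], shifting [a] by [d^-1] multiplies the sum by [w], which is not 1. *)
Lemma sum_add_char d : \sum_a add_char (a * d) = if d == 0 then p%:R else 0.
Proof.
case: eqP => [->|/eqP d0].
  rewrite (eq_bigr (fun=> 1)) => [|a _]; last by rewrite mulr0 /add_char expr0.
  by rewrite sumr_const card_Fp.
have : \sum_a add_char (a * d) = w * \sum_a add_char (a * d).
  rewrite {1}(reindex_inj (addIr d^-1)) /= mulr_sumr; apply: eq_bigr => a _.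
  rewrite mulrDl mulVf // add_charD mulrC; congr (_ * _).
have w1 : w != 1.
  apply: contraTneq (prime_gt1 p_pr) => w1.
  by rewrite -leqNgt dvdn_leq // (prim_order_dvd wP) w1 expr1n.
move/eqP; rewrite -subr_eq0 -{1}[\sum_a _]mul1r -mulrBl mulf_eq0 subr_eq0 eq_sym.
by rewrite (negbTE w1) => /eqP.
Qed.

Lemma gauss_sum_sqr : gauss_sum ^+ 2 = ((-1) ^+ (p.-1)./2 * p%:Z)%:~R.
Proof.
have oddF : odd #|'F_p| by rewrite card_Fp.
(* Substituting [b = a * c] in the double sum cancels [quad_char a] against itself; the terms with
   [a = 0] vanish and are left out. *)
have -> : gauss_sum ^+ 2 =
    \sum_c \sum_(a | a != 0) (quad_char c)%:~R * add_char (a * (1 + c)).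
  rewrite exprS expr1 {1}/gauss_sum exchange_big /= mulr_suml.
  rewrite (bigD1 0) //= quad_char0 mulr0z !mul0r add0r.
  apply: eq_bigr => a a0; rewrite /gauss_sum mulr_sumr.
  rewrite (reindex_inj (mulfI a0)) /=; apply: eq_bigr => c _.
  rewrite mulrACA -add_charD -rmorphM quad_charM // mulrA quad_char_sqr // mul1r.
  by rewrite mulrDr mulr1.
(* Restoring [a = 0] completes the inner sum, which is then nonzero only for [c = -1]; the
   corrections [quad_char c] add up to zero. *)
have Dsum c : \sum_(a | a != 0) (quad_char c)%:~R * add_char (a * (1 + c)) =
    (quad_char c)%:~R * (if c == -1 then p%:R else 0) - (quad_char c)%:~R.
  rewrite -mulr_sumr -[X in _ - X]mulr1 -mulrBr; congr (_ * _).
  rewrite [c == -1]eq_sym -subr_eq0 -opprD oppr_eq0 -sum_add_char.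
  rewrite [in RHS](bigD1 0) //= mul0r.
  by rewrite (_ : add_char 0 = 1) ?expr0 // addrAC subrr add0r.
rewrite (eq_bigr _ (fun c _ => Dsum c)) sumrB.
rewrite -(rmorph_sum intr) /= sum_quad_char // subr0.
rewrite (bigD1 (-1)) //= eqxx big1 ?addr0 => [|c /negbTE->]; last by rewrite mulr0.
by rewrite quad_charN1 // card_Fp // rmorphM.
Qed.

(** Replacing [a] by [k * a] turns [w ^+ a] into its [k]-th power and brings out the factor
    [quad_char k], whose square is 1. *)
Lemma gauss_sum_aut (u : {rmorphism algC -> algC}) k : coprime k p ->
  u w = w ^+ k -> u gauss_sum = (legendre k p)%:~R * gauss_sum.
Proof.
move=> co_k_p uw; have oddF : odd #|'F_p| by rewrite card_Fp.
have k0 : (k%:R : 'F_p) != 0.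
  by rewrite -[0]/(0%:R) eqFp_nat // mod0n -/(dvdn _ _) -prime_coprime // coprime_sym.
rewrite legendre_quad_char // [in RHS]/gauss_sum (reindex_inj (mulfI k0)) /=.
rewrite rmorph_sum mulr_sumr; apply: eq_bigr => a _.
rewrite rmorphM rmorph_int mulrA -rmorphM /= quad_charM // mulrA quad_char_sqr // mul1r.
by rewrite add_charMn /add_char rmorphXn /= uw exprAC.
Qed.

End GaussSum.

(** * Square roots in cyclotomic fields and their Galois characters *)

(* [c] is the quadratic character describing the action of the Galois group
   of the [n]-th cyclotomic field on a square root of [d]. *)
Definition cyclotomic_sqrt (n : nat) (d : int) (c : nat -> int) : Prop :=
  exists s : algC, [/\ s ^+ 2 = d%:~R,
    forall z, n.-primitive_root z -> in_Qz z s &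
    forall k (u : {rmorphism algC -> algC}), coprime k n ->
      (forall y, y ^+ n = 1 -> u y = y ^+ k) -> u s = (c k)%:~R * s].

Lemma cyclotomic_sqrt1 n : cyclotomic_sqrt n 1 (fun=> 1).
Proof.
exists 1; split=> [|z _|k u _ _]; [exact: expr1n | exact: (in_Qz_int z 1) |].
by rewrite rmorph1 mulr1.
Qed.

Lemma cyclotomic_sqrtM n d1 c1 d2 c2 :
  cyclotomic_sqrt n d1 c1 -> cyclotomic_sqrt n d2 c2 ->
  cyclotomic_sqrt n (d1 * d2) (fun k => c1 k * c2 k).
Proof.
move=> [s1 [sq1 in1 u1]] [s2 [sq2 in2 u2]]; exists (s1 * s2); split.
- by rewrite exprMn sq1 sq2 rmorphM.
- by move=> z zP; apply: in_QzM; [apply: in1|apply: in2].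
move=> k u co_k Du; rewrite rmorphM (u1 k u) // (u2 k u) // rmorphM /=.
by rewrite mulrACA.
Qed.

Lemma cyclotomic_sqrtX n d c (b : bool) : (b -> cyclotomic_sqrt n d c) ->
  cyclotomic_sqrt n (d ^+ b) (fun k => c k ^+ b).
Proof.
by case: b => [/(_ isT)//|_]; apply: cyclotomic_sqrt1.
Qed.

(** For a primitive eighth root of unity [t], the sum of [t] and its inverse [t ^+ 7] squares to 2.
    Its image under [u] is the same sum for [t ^+ k], which depends only on [k] modulo 8. *)
Lemma cyclotomic_sqrt2 n : (0 < n)%N -> (8 %| n)%N -> cyclotomic_sqrt n 2 chi8.
Proof.
move=> n_gt0 dvd8; have [z zP] := C_prim_root_exists n_gt0.
have tP : 8.-primitive_root (z ^+ (n %/ 8)) by apply: dvdn_prim_root.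
move: (_ ^+ _) tP => t tP.
have tn1 : t ^+ n = 1 by apply/eqP; rewrite -(prim_order_dvd tP).
have t4 : t ^+ 4 = -1.
  have /eqP : (t ^+ 4) ^+ 2 = 1 by rewrite -exprM (prim_expr_order tP).
  rewrite sqrf_eq1.
  by rewrite -(prim_order_dvd tP) /= => /eqP.
have t8 : t ^+ 8 = 1 := prim_expr_order tP.
exists (t + t ^+ 7); split.
- rewrite sqrrD -exprM -exprS t8 (_ : t ^+ (7 * 2) = - t ^+ 2).
    by rewrite addrAC subrr add0r.
  by rewrite (exprD t 8 6) (exprD t 4 2) t8 t4 mul1r mulN1r.
- move=> z' z'P; apply: in_QzD; apply: (in_Qz_unity z'P) => //.
  by rewrite exprAC tn1 expr1n.
move=> k u co_k Du; rewrite rmorphD rmorphXn /= !Du // -(prim_expr_mod tP).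
have : odd k.
  by rewrite -coprime2n coprime_sym; apply: coprime_dvdr co_k; apply: dvdn_trans dvd8.
have t5 : t ^+ 5 = - t by rewrite (exprD t 4 1) t4 expr1 mulN1r.
have t3 : t ^+ 3 = - t ^+ 7 by rewrite (exprD t 4 3) t4 mulN1r opprK.
have k8 : (k %% 8 < 8)%N by rewrite ltn_mod.
rewrite -(odd_mod k (erefl : odd 8 = false)) /chi8.
move: (k %% 8)%N k8; do 8?[case=> //] => _ _ /=; rewrite -exprM -?(prim_expr_mod tP (_ * _)).
- by rewrite mul1r.
- by rewrite t5 t3 mulN1r opprD addrC.
- by rewrite t5 t3 mulN1r opprD.
- by rewrite mul1r addrC.
Qed.

(** The square root is a primitive fourth root of unity, whose odd powers are itself and its
    negative. *)
Lemma cyclotomic_sqrtN1 n : (0 < n)%N -> (4 %| n)%N -> cyclotomic_sqrt n (-1) leg4.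
Proof.
move=> n_gt0 dvd4; have [z zP] := C_prim_root_exists n_gt0.
have tP : 4.-primitive_root (z ^+ (n %/ 4)) by apply: dvdn_prim_root.
move: (_ ^+ _) tP => t tP.
have tn1 : t ^+ n = 1 by apply/eqP; rewrite -(prim_order_dvd tP).
have t2 : t ^+ 2 = -1.
  have /eqP : (t ^+ 2) ^+ 2 = 1 by rewrite -exprM (prim_expr_order tP).
  rewrite sqrf_eq1.
  by rewrite -(prim_order_dvd tP) /= => /eqP.
exists t; split=> // [z' z'P|k u co_k Du]; first exact: (in_Qz_unity z'P).
rewrite Du // -(prim_expr_mod tP) /leg4.
have : odd k.
  by rewrite -coprime2n coprime_sym; apply: coprime_dvdr co_k; apply: dvdn_trans dvd4.
have k4 : (k %% 4 < 4)%N by rewrite ltn_mod.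
rewrite -(odd_mod k (erefl : odd 4 = false)).
move: (k %% 4)%N k4; do 4?[case=> //] => _ _ /=; first by rewrite mul1r.
by rewrite (exprD t 2 1) t2 expr1.
Qed.

Lemma cyclotomic_sqrt_prime n p : (0 < n)%N -> [&& prime p, odd p & (p %| n)%N] ->
  cyclotomic_sqrt n ((-1) ^+ (p.-1)./2 * p%:Z) (legendre^~ p).
Proof.
move=> n_gt0 /and3P[p_pr p_odd p_n]; have [z zP] := C_prim_root_exists n_gt0.
have wP : p.-primitive_root (z ^+ (n %/ p)) by apply: dvdn_prim_root.
move: (_ ^+ _) wP => w wP.
have wn1 : w ^+ n = 1 by apply/eqP; rewrite -(prim_order_dvd wP).
exists (gauss_sum p w); split; first exact: gauss_sum_sqr.
- move=> z' z'P; apply: in_Qz_sum => a _; apply: in_QzM; first exact: in_Qz_int.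
  by apply: (in_Qz_unity z'P); rewrite /add_char exprAC wn1 expr1n.
move=> k u co_k Du; apply: gauss_sum_aut => //; last exact: Du.
exact: coprime_dvdr co_k.
Qed.

(** The quadratic character with kernel [H_Delta], kept as an integer because its value -1 is needed
    too. *)
Definition Delta_char (w0 w : bool) (S : seq nat) (k : nat) : int :=
  chi8 k ^+ w0 * leg4 k ^+ w * \prod_(p <- S) legendre k p.

Lemma Delta_char_pm1 (w0 w : bool) S n k :
  (forall p, p \in S -> [&& prime p, odd p & (p %| n)%N]) -> coprime k n ->
  (Delta_char w0 w S k == 1) || (Delta_char w0 w S k == -1).
Proof.
move=> S_n co_k; pose pm1 (c : int) := (c == 1) || (c == -1).
have pm1M c d : pm1 c -> pm1 d -> pm1 (c * d) by move=> /orP[]/eqP-> /orP[]/eqP->.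
have pm1X c (b : bool) : pm1 c -> pm1 (c ^+ b) by case: b.
rewrite -/(pm1 _); apply: (pm1M); first apply: (pm1M); try apply: pm1X.
- by rewrite /chi8; case: ifP.
- by rewrite /leg4; case: ifP.
rewrite big_seq; apply: (big_ind pm1) => // p /S_n/and3P[p_pr _ p_n].
rewrite /legendre ifF; first by case: ifP.
have : coprime p k by rewrite coprime_sym (coprime_dvdr p_n).
by rewrite prime_coprime // => /negbTE.
Qed.

Lemma cyclotomic_sqrt_Delta (w0 w : bool) S n : (0 < n)%N ->
  (forall p, p \in S -> [&& prime p, odd p & (p %| n)%N]) ->
  (w0 -> (8 %| n)%N) -> (w -> (4 %| n)%N) ->
  cyclotomic_sqrt n (Delta w0 w S) (Delta_char w0 w S).
Proof.
move=> n_gt0 S_n w0_n w_n; apply: cyclotomic_sqrtM; first apply: cyclotomic_sqrtM.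
- by apply: cyclotomic_sqrtX => /w0_n; apply: cyclotomic_sqrt2.
- by apply: cyclotomic_sqrtX => /w_n; apply: cyclotomic_sqrtN1.
elim: S S_n => [|p S IHS] S_n.
  have [s sP] := cyclotomic_sqrt1 n; exists s.
  case: sP => sq in_s us; split=> [|//|k u co_k Du]; first by rewrite big_nil.
  by rewrite big_nil (us k u).
have Sp : [&& prime p, odd p & (p %| n)%N] by rewrite S_n ?mem_head.
have [|s sP] := cyclotomic_sqrtM (cyclotomic_sqrt_prime n_gt0 Sp) (IHS _).
  by move=> q qS; rewrite S_n // inE qS orbT.
exists s; case: sP => sq in_s us; split=> [|//|k u co_k Du]; first by rewrite big_cons.
by rewrite big_cons (us k u).
Qed.

(** The root built from Gauss sums agrees with [sqrtC] only up to sign, but both properties are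
    insensitive to the sign. *)
Lemma sqrt_Delta_Galois (w0 w : bool) S n : (0 < n)%N ->
  (forall p, p \in S -> [&& prime p, odd p & (p %| n)%N]) ->
  (w0 -> (8 %| n)%N) -> (w -> (4 %| n)%N) ->
  let sD : algC := sqrtC (Delta w0 w S)%:~R in
  (forall z, n.-primitive_root z -> in_Qz z sD) /\
  (forall k (u : {rmorphism algC -> algC}), coprime k n ->
    (forall y, y ^+ n = 1 -> u y = y ^+ k) -> u sD = (Delta_char w0 w S k)%:~R * sD).
Proof.
move=> n_gt0 S_n w0_n w_n sD.
have [s [sq in_s us]] := cyclotomic_sqrt_Delta n_gt0 S_n w0_n w_n.
have : sD ^+ 2 == s ^+ 2 by rewrite sqrtCK sq.
rewrite eqf_sqr => /orP[]/eqP->; first by [].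
split=> [z zP|k u co_k Du]; last by rewrite rmorphN (us k u) // mulrN.
by rewrite -mulN1r; apply: in_QzM; [apply: (in_Qz_int z (-1))|apply: in_s].
Qed.

(** * Square roots of Delta *)

(** A prime divisor of [m] would have exponent at least 2 in the product, whereas its exponent there
    is its multiplicity in the duplicate-free list [T]. *)
Lemma squarefree_prod_primes (T : seq nat) m : uniq T -> all prime T ->
  (m ^ 2 %| \prod_(p <- T) p)%N -> m = 1%N.
Proof.
move=> uniqT prT dvm; apply/eqP; apply: contraT => m1.
have P_gt0 : (0 < \prod_(p <- T) p)%N.
  by rewrite big_seq prodn_cond_gt0 // => p /(allP prT)/prime_gt0.
have m_gt0 : (0 < m)%N by move: (dvdn_gt0 P_gt0 dvm); rewrite expn_gt0 orbF.
have m_gt1 : (1 < m)%N by rewrite ltn_neqAle eq_sym m1.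
pose l := pdiv m; have l_pr : prime l := pdiv_prime m_gt1.
have : (logn l (\prod_(p <- T) p) <= 1)%N.
  have -> : logn l (\prod_(p <- T) p) = count_mem l T.
    elim: T prT {uniqT dvm P_gt0} => [|p T IHT] /=; first by rewrite big_nil logn1.
    case/andP=> p_pr prT; rewrite big_cons lognM ?(prime_gt0 p_pr) //; last first.
      by rewrite big_seq prodn_cond_gt0 // => q /(allP prT)/prime_gt0.
    by rewrite IHT // logn_prime // eq_sym.
  by rewrite count_uniq_mem //; case: (_ \in _).
rewrite leqNgt => /negP[]; rewrite -pfactor_dvdn //.
by apply: dvdn_trans dvm; rewrite dvdn_exp2r // pdiv_dvd.
Qed.

Lemma absz_Delta (w0 w : bool) S :
  `|Delta w0 w S|%N = (\prod_(p <- if w0 then 2 :: S else S) p)%N.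
Proof.
rewrite /Delta !abszM abszX absz_sign muln1.
have -> : `|(\prod_(p <- S) ((-1) ^+ (p.-1)./2 * p%:Z))%R|%N = (\prod_(p <- S) p)%N.
  elim: S => [|p S IHS]; first by rewrite !big_nil.
  by rewrite !big_cons !abszM IHS abszX exp1n mul1n absz_nat.
by case: w0; rewrite ?big_cons // mul1n.
Qed.

Section Delta.

Variables (w0 w : bool) (S : seq nat) (n : nat).
Hypotheses (n_gt0 : (0 < n)%N) (uniqS : uniq S).
Hypothesis S_n : forall p, p \in S -> [&& prime p, odd p & (p %| n)%N].

Lemma Delta_squarefree m : (m ^ 2 %| `|Delta w0 w S|)%N -> m = 1%N.
Proof.
have prS : all prime S by apply/allP => p /S_n/and3P[].
rewrite absz_Delta; case: w0; apply: squarefree_prod_primes => //=.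
by rewrite uniqS andbT; apply/negP => /S_n/and3P[].
Qed.

(** Zero would be divisible by the square of 2. *)
Lemma Delta_neq0 : Delta w0 w S != 0.
Proof. by apply/eqP => D0; have := @Delta_squarefree 2; rewrite D0 dvdn0 => /(_ isT). Qed.

(** With [q] in lowest terms, the squared denominator is coprime to the squared numerator, so it
    divides the squarefree [Delta] and the denominator is 1. *)
Lemma Delta_sqr_int (q : algC) : q \in Crat ->
  q ^+ 2 * (Delta w0 w S)%:~R \in Num.int -> q \in Num.int.
Proof.
case/CratP=> a -> /intrP[z].
rewrite -rmorphXn -(ratr_int algC (Delta w0 w S)) -rmorphM /=.
rewrite -(ratr_int algC z) => /fmorph_inj Da.
have Da' : numq a ^+ 2 * Delta w0 w S = z * denq a ^+ 2.
  move: (Delta w0 w S) Da => d Da; apply: (@intr_inj rat).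
  by rewrite !rmorphM /= -Da numqE mulrACA -!expr2 mulrAC.
have : (denq a ^+ 2 %| numq a ^+ 2 * Delta w0 w S)%Z by rewrite Da' dvdz_mull.
have co : coprimez (denq a ^+ 2) (numq a ^+ 2).
  by rewrite coprimezXl // coprimezXr // coprimezE coprime_sym coprime_num_den.
rewrite Gauss_dvdzr // dvdzE abszX => /Delta_squarefree Dd.
have := divq_num_den a; rewrite -absz_denq Dd divr1 => <-.
by rewrite ratr_int.
Qed.

Hypotheses (w0_n : w0 -> (8 %| n)%N) (w_n : w -> (4 %| n)%N).

(** If the character were trivial, every automorphism would fix the square root of [Delta], making
    it rational, then an integer; a squarefree perfect square is 1. *)
Lemma Delta_char_nontrivial : Delta w0 w S <> 1 ->
  exists2 k, coprime k n & Delta_char w0 w S k = -1.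
Proof.
move=> D1; have [z zP] := C_prim_root_exists n_gt0.
have [in_sD aut_sD] := sqrt_Delta_Galois n_gt0 S_n w0_n w_n.
set sD := sqrtC _ in in_sD aut_sD.
have sD2 : sD ^+ 2 = (Delta w0 w S)%:~R by rewrite sqrtCK.
have sD0 : sD != 0 by rewrite sqrtC_eq0 intr_eq0 Delta_neq0.
have [/existsP[k /andP[co_k /eqP Dk]]|] :=
  boolP [exists k : 'I_n, coprime k n && (Delta_char w0 w S k == -1)].
  by exists k.
rewrite negb_exists => /forallP triv; case: D1.
have sD_rat : sD \in Crat.
  apply: (in_Qz_fixed_rat zP (in_sD z zP)) => k u co_k Du.
  have co_k' : coprime (k %% n) n by rewrite coprime_modl.
  (* Non-existence is known only for residues in ['I_n]; [u] acts on [n]-th roots of unity equally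
     well as the power [k %% n]. *)
  rewrite (aut_sD (k %% n)%N) // => [|y yn1]; last by rewrite Du // expr_mod.
  have := triv (Ordinal (ltn_pmod k n_gt0)); rewrite /= co_k' /=.
  by case/orP: (Delta_char_pm1 w0 w S_n co_k') => /eqP->; rewrite ?eqxx // mul1r.
have /intrP[a Da] : sD \in Num.int.
  by apply: Delta_sqr_int => //; rewrite sD2 -rmorphM rpred_int.
have DE : Delta w0 w S = a ^+ 2.
  by apply: (@intr_inj algC); rewrite -sD2 Da rmorphXn.
have a1 : `|a|%N = 1%N by apply: Delta_squarefree; rewrite DE abszX.
by rewrite DE -real_normK ?num_real // -abszE a1.
Qed.

End Delta.

(** * Eigenvalues of normal Cayley matrices *)

Lemma Aint_eigenvalue n (A : 'M[int]_n) (l : algC) :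
  eigenvalue (map_mx intr A) l -> l \in Aint.
Proof.
rewrite eigenvalue_root_char => /root_monic_Aint; apply.
  exact: char_poly_monic.
by rewrite -map_char_poly; apply/polyOverP => i; rewrite coef_map /= rpred_int.
Qed.

Section CayleyEigenvalues.

Variable gT : finGroupType.
Local Notation G := [set: gT]%G.
Local Notation n := (exponent [set: gT]).

Definition class_fun (R : Type) (f : gT -> R) := forall x y, f (x ^ y)%g = f x.

Definition cayley_mx (f : gT -> algC) : 'M[algC]_#|gT| :=
  \matrix_(i, j) f (enum_val j * (enum_val i)^-1)%g.

Definition irr_eigen (f : gT -> algC) (i : Iirr G) : algC :=
  (\sum_g f g * 'chi_i g) / 'chi_i 1%g.

Lemma irr_mulC (i : Iirr G) g h : 'chi_i (g * h)%g = 'chi_i (h * g)%g.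
Proof. by rewrite -(cfunJ _ (h * g)%g (in_setT h)) conjgE -mulgA mulKg. Qed.

(* Schur's lemma: [\sum_h f h *: 'Chi_i h] is a scalar matrix. *)
Lemma irr_convolution f (i : Iirr G) g : class_fun f ->
  \sum_h f h * 'chi_i (h * g)%g = irr_eigen f i * 'chi_i g.
Proof.
move=> f_class; pose rG := 'Chi_i; pose T := \sum_h f h *: rG h.
have cT : is_scalar_mx T.
  apply: (mx_abs_irr_cent_scalar (groupC (socle_irr _))).
  apply/centgmxP => x Gx; rewrite mulmx_suml mulmx_sumr.
  rewrite [RHS](reindex_inj (can_inj (conjgK x))) /=; apply: eq_bigr => h _.
  rewrite f_class -scalemxAl -scalemxAr -!repr_mxM ?inE //.
  by rewrite conjgE !mulgA mulgV mul1g.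
have [a Da] := is_scalar_mxP cT.
have conv x : \sum_h f h * 'chi_i (h * x)%g = a * 'chi_i x.
  have -> : a * 'chi_i x = \tr (T *m rG x).
    by rewrite Da mul_scalar_mx mxtraceZ -irrRepr cfunE inE mulr1n.
  rewrite mulmx_suml raddf_sum; apply: eq_bigr => h _ /=.
  by rewrite -scalemxAl mxtraceZ -repr_mxM ?inE // -irrRepr cfunE inE mulr1n.
(* Evaluating the identity at 1 identifies the scalar [a]. *)
rewrite conv /irr_eigen; have := conv 1%g.
under eq_bigr do rewrite mulg1; move=> ->.
by rewrite mulfK ?irr1_neq0.
Qed.

Lemma irr_eigenD (f1 f2 : gT -> int) i :
  irr_eigen (fun g => (f1 g + f2 g)%:~R) i =
  irr_eigen (fun g => (f1 g)%:~R) i + irr_eigen (fun g => (f2 g)%:~R) i.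
Proof.
rewrite /irr_eigen -mulrDl -big_split; congr (_ / _); apply: eq_bigr => g _.
by rewrite rmorphD mulrDl.
Qed.

(** Up to a nonzero scalar, the projection of the regular representation onto its [i]-th isotypic
    component. *)
Definition irr_mx (i : Iirr G) := cayley_mx (fun x => 'chi_i x^-1%g).

Lemma sum_enum_val (F : gT -> algC) : \sum_(i < #|gT|) F (enum_val i) = \sum_g F g.
Proof. by rewrite [RHS]big_enum_val. Qed.

Lemma cayley_mx_irr f i : class_fun f ->
  cayley_mx f *m irr_mx i = irr_eigen f i *: irr_mx i.
Proof.
move=> f_class; apply/matrixP => a b; rewrite !mxE.
rewrite -irr_convolution //.
under eq_bigr do rewrite !mxE.
rewrite (sum_enum_val (fun c => f (c * (enum_val a)^-1)%g * 'chi_i (enum_val b * c^-1)^-1%g)).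
rewrite (reindex_inj (mulIg (enum_val a))) /=; apply: eq_bigr => h _.
by rewrite mulgK !invMg !invgK mulgA.
Qed.

(** Since [eigenvalue] refers to row vectors, this side makes the rows of [irr_mx i] eigenvectors.
    The substitution is [c = h^-1 * b]. *)
Lemma irr_mx_cayley f i : class_fun f ->
  irr_mx i *m cayley_mx f = irr_eigen f i *: irr_mx i.
Proof.
move=> f_class; apply/matrixP => a b; rewrite !mxE.
rewrite -irr_convolution //.
under eq_bigr do rewrite !mxE.
rewrite (sum_enum_val (fun c => 'chi_i (c * (enum_val a)^-1)^-1%g * f (enum_val b * c^-1)%g)).
rewrite (reindex_inj (inj_comp (mulIg (enum_val b)) invg_inj)) /=; apply: eq_bigr => h _.
by rewrite !invMg !invgK mulKVg mulrC mulgA irr_mulC mulgA.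
Qed.

(** This is the decomposition of the regular character, which vanishes away from 1. *)
Lemma sum_irr_mx : \sum_i 'chi_i 1%g *: irr_mx i = #|gT|%:R%:M.
Proof.
apply/matrixP => a b; rewrite summxE !mxE.
have := cfRegE G (enum_val b * (enum_val a)^-1)^-1%g.
rewrite cfReg_sum sum_cfunE; under eq_bigr do rewrite cfunE.
move=> H; under eq_bigr do rewrite !mxE.
by rewrite H cardsT -eq_invg1 invgK -eq_mulgV1 (inj_eq enum_val_inj) eq_sym.
Qed.

Lemma card_gT_neq0 : #|gT|%:R != 0 :> algC.
Proof. by rewrite pnatr_eq0 -cardsT -lt0n cardG_gt0. Qed.

Lemma irr_mx_neq0 i : irr_mx i != 0.
Proof.
apply/eqP => /matrixP/(_ (enum_rank 1%g) (enum_rank 1%g))/eqP.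
by rewrite !mxE enum_rankK mulgV invg1 (negbTE (irr1_neq0 i)).
Qed.

(** The matrices [irr_mx i] span a nonzero multiple of the identity, so some [v *m irr_mx i] is
    nonzero, and comparing both actions on it gives [l]. Conversely, a nonzero row of [irr_mx i] is
    an eigenvector. *)
Lemma eigenvalue_cayley f l : class_fun f ->
  eigenvalue (cayley_mx f) l <-> exists i, l = irr_eigen f i.
Proof.
move=> f_class; split=> [/eigenvalueP[v vM v0]|[i ->]].
  have [i vE0] : exists i, v *m irr_mx i != 0.
    apply/existsP; apply: contraNT v0; rewrite negb_exists => /forallP vE.
    rewrite -(inj_eq (scalerI card_gT_neq0)) scaler0 -mul_mx_scalar -sum_irr_mx.
    rewrite mulmx_sumr big1 // => i _; have := vE i; rewrite negbK => /eqP vEi.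
    by rewrite -scalemxAr vEi scaler0.
  exists i; apply/eqP; rewrite -subr_eq0; apply: contraNT vE0 => l0.
  apply/eqP/(scalerI l0); rewrite scaler0 scalerBl scalemxAl -vM -mulmxA.
  by rewrite cayley_mx_irr // -scalemxAr subrr.
have [a va] : exists a, row a (irr_mx i) != 0.
  apply/existsP; apply: contraNT (irr_mx_neq0 i); rewrite negb_exists => /forallP E0.
  by apply/eqP/row_matrixP => a; have := E0 a; rewrite negbK row0 => /eqP.
apply/eigenvalueP; exists (row a (irr_mx i)) => //.
by rewrite -row_mul irr_mx_cayley // linearZ.
Qed.

(** Both Cayley matrices have the same product with each [irr_mx i], hence with their weighted sum,
    a nonzero scalar matrix; the row indexed by 1 recovers the functions. *)
Lemma irr_eigen_inj f f' : class_fun f -> class_fun f' ->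
  irr_eigen f =1 irr_eigen f' -> f =1 f'.
Proof.
move=> f_class f'_class eq_ff' g.
have : #|gT|%:R *: cayley_mx f = #|gT|%:R *: cayley_mx f'.
  rewrite -!mul_mx_scalar -sum_irr_mx !mulmx_sumr; apply: eq_bigr => i _.
  by rewrite -!scalemxAr !cayley_mx_irr // eq_ff'.
move/(scalerI card_gT_neq0)/matrixP/(_ (enum_rank 1%g) (enum_rank g)).
by rewrite !mxE !enum_rankK invg1 mulg1.
Qed.

(** * Galois action on characters and eigenvalues *)

Lemma irr_expg_sum (i : Iirr G) g : exists m, exists e : 'I_m -> algC,
  (forall j, e j ^+ n = 1) /\ forall k, 'chi_i (g ^+ k)%g = \sum_j e j ^+ k.
Proof.
(* The matrix of [g] is diagonalizable with roots of unity as eigenvalues, and one base change [B]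
   serves all its powers. *)
have [e [[B uB Dg] [e1 _] _ _]] := repr_rsim_diag 'Chi_i (in_setT g).
exists _, (e 0); split=> [j|k].
  have /dvdnP[q ->] : (#[g]%g %| n)%N by rewrite dvdn_exponent ?inE.
  by rewrite mulnC exprM e1 expr1n.
rewrite -irrRepr cfunE inE mulr1n.
have -> : 'Chi_i (g ^+ k)%g = invmx B *m diag_mx (\row_j e 0 j ^+ k) *m B.
  elim: k => [|k IHk].
    have -> : \row_j e 0 j ^+ 0 = const_mx 1 by apply/rowP => j; rewrite !mxE.
    by rewrite expg0 repr_mx1 diag_const_mx mulmx1 mulVmx.
  rewrite expgS repr_mxM ?inE // {}IHk Dg !mulmxA mulmxK //.
  congr (_ *m _); rewrite -!mulmxA mulmx_diag; congr (_ *m diag_mx _).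
  by apply/rowP => j; rewrite !mxE exprS.
by rewrite mxtrace_mulC mulmxA mulmxV // mul1mx mxtrace_diag; apply: eq_bigr => j _; rewrite mxE.
Qed.

Lemma irr_aut (u : {rmorphism algC -> algC}) k (i : Iirr G) g :
  (forall y, y ^+ n = 1 -> u y = y ^+ k) -> u ('chi_i g) = 'chi_i (g ^+ k)%g.
Proof.
move=> Du; have [m [e [en1 De]]] := irr_expg_sum i g.
rewrite De -[g in LHS]expg1 De rmorph_sum; apply: eq_bigr => j _.
by rewrite expr1 Du.
Qed.

Lemma expg_coprime_inv k : coprime k n ->
  exists k', [/\ coprime k' n, (k * k' = 1 %[mod n])%N & forall g : gT, (g ^+ (k * k') = g)%g].
Proof.
move=> co_k_n; have kk'1 : (k * k ^ (totient n).-1 = 1 %[mod n])%N.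
  by rewrite -expnS prednK ?totient_gt0 ?exponent_gt0 // Euler_exp_totient.
exists (k ^ (totient n).-1)%N; split=> // [|g]; first by rewrite coprimeXl.
have gn1 : (g ^+ n = 1)%g by rewrite expg_exponent ?inE.
by rewrite -(expg_mod _ gn1) kk'1 expg_mod.
Qed.

Lemma expg_coprime_inj k : coprime k n -> injective (fun g : gT => g ^+ k)%g.
Proof.
by case/expg_coprime_inv=> k' [_ _ kk'] g h /(congr1 (natexp^~ k')); rewrite -!expgM !kk'.
Qed.

(** Here [u] takes ['chi_i g] to ['chi_i (g ^+ k)], and the sum is reindexed by the bijection [g] to
    [g ^+ k]. *)
Lemma irr_eigen_aut (u : {rmorphism algC -> algC}) k (f : gT -> int) i :
    coprime k n -> (forall y, y ^+ n = 1 -> u y = y ^+ k) ->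
  u (irr_eigen (fun g => (f (g ^+ k)%g)%:~R) i) = irr_eigen (fun g => (f g)%:~R) i.
Proof.
move=> co_k Du; rewrite /irr_eigen fmorph_div /= (irr_aut _ _ Du) expg1n.
congr (_ / _); rewrite rmorph_sum [RHS](reindex_inj (expg_coprime_inj co_k)) /=.
by apply: eq_bigr => g _; rewrite rmorphM rmorph_int (irr_aut _ _ Du).
Qed.

Lemma in_Qz_irr_eigen z (f : gT -> int) i : n.-primitive_root z ->
  in_Qz z (irr_eigen (fun g => (f g)%:~R) i).
Proof.
move=> zP; apply: in_QzM.
  apply: in_Qz_sum => g _; apply: in_QzM; first exact: in_Qz_int.
  have [m [e [en1 De]]] := irr_expg_sum i g.
  by rewrite -[g]expg1 De; apply: in_Qz_sum => j _; apply: (in_Qz_unity zP); rewrite expr1.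
have /natrP[m ->] := Cnat_irr1 i.
by rewrite -(ratr_nat algC) -fmorphV; apply: in_Qz_rat.
Qed.

Lemma irr_eigen_Aint (f : gT -> int) i : class_fun f ->
  irr_eigen (fun g => (f g)%:~R) i \in Aint.
Proof.
move=> f_class.
have : eigenvalue (cayley_mx (fun g => (f g)%:~R)) (irr_eigen (fun g => (f g)%:~R) i).
  by apply/eigenvalue_cayley; [move=> x y; rewrite f_class | exists i].
have -> : cayley_mx (fun g => (f g)%:~R) =
    map_mx intr (\matrix_(a, b) f (enum_val b * (enum_val a)^-1)%g).
  by apply/matrixP => a b; rewrite !mxE.
exact: Aint_eigenvalue.
Qed.

(** By [irr_eigen_aut], the condition on [u] says that the class functions [f (g ^+ k)] and
    [c * f g] have equal eigenvalues, and these determine a class function. *)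
Lemma irr_eigen_aut_sign (u : {rmorphism algC -> algC}) k (c : int) (f : gT -> int) :
    class_fun f -> coprime k n -> (forall y, y ^+ n = 1 -> u y = y ^+ k) -> c * c = 1 ->
  (forall i, u (irr_eigen (fun g => (f g)%:~R) i) = c%:~R * irr_eigen (fun g => (f g)%:~R) i)
  <-> (forall g, f (g ^+ k)%g = c * f g).
Proof.
move=> f_class co_k Du cc1.
have eigenZ i : irr_eigen (fun g => (c * f g)%:~R) i = c%:~R * irr_eigen (fun g => (f g)%:~R) i.
  rewrite /irr_eigen mulrA mulr_sumr; congr (_ / _); apply: eq_bigr => g _.
  by rewrite intrM mulrA.
split=> [Hu g|Hf i].
  apply: (@intr_inj algC); move: g.
  apply: irr_eigen_inj => [x y|x y|i]; rewrite -?conjXg ?f_class //.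
  apply: (fmorph_inj u); rewrite (irr_eigen_aut f i co_k Du) eigenZ rmorphM Hu rmorph_int.
  by rewrite mulrA -intrM cc1 mul1r.
rewrite -[in RHS](irr_eigen_aut _ _ co_k Du).
have -> : irr_eigen (fun g => (f (g ^+ k)%g)%:~R) i = irr_eigen (fun g => (c * f g)%:~R) i.
  by rewrite /irr_eigen; under eq_bigr do rewrite Hf.
by rewrite eigenZ [in RHS]rmorphM rmorph_int mulrA -intrM cc1 mul1r.
Qed.

End CayleyEigenvalues.

(** * Eigenvalues in quadratic fields *)

Section DeltaCharacter.

Variables (w0 w : bool) (S : seq nat) (n : nat).
Hypotheses (n_gt0 : (0 < n)%N).
Hypothesis S_n : forall p, p \in S -> [&& prime p, odd p & (p %| n)%N].
Hypotheses (uniqS : uniq S) (w0_n : w0 -> (8 %| n)%N) (w_n : w -> (4 %| n)%N).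

(** Read off from the composite of two automorphisms acting on the nonzero square root of [Delta],
    without treating the factors of the character separately. *)
Lemma Delta_charM k l : coprime k n -> coprime l n ->
  Delta_char w0 w S (k * l) = Delta_char w0 w S k * Delta_char w0 w S l.
Proof.
move=> co_k co_l; have [_ aut_sD] := sqrt_Delta_Galois n_gt0 S_n w0_n w_n.
have [u Du] := Qn_aut_exists co_k; have [v Dv] := Qn_aut_exists co_l.
have co_kl : coprime (k * l) n by rewrite coprimeMl co_k.
have := aut_sD _ (u \o v : {rmorphism algC -> algC}) co_kl.
rewrite /= (aut_sD l v) // rmorphM rmorph_int /= (aut_sD k u) // => H.
apply: (@intr_inj algC).
have sD0 : sqrtC (Delta w0 w S)%:~R != 0 :> algC.
  by rewrite sqrtC_eq0 intr_eq0 (Delta_neq0 w0 w uniqS S_n).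
apply: (mulIf sD0); rewrite -H => [|y yn1].
  by rewrite mulrCA [in RHS]intrM mulrA.
by rewrite Dv // rmorphXn /= Du // exprM.
Qed.

(** The identity automorphism acts as the power [k] on the [n]-th roots of unity. *)
Lemma Delta_char_mod1 k : k = 1 %[mod n] -> Delta_char w0 w S k = 1.
Proof.
move=> k1; have [_ aut_sD] := sqrt_Delta_Galois n_gt0 S_n w0_n w_n.
have co_k : coprime k n by rewrite -coprime_modl k1 coprime_modl coprime1n.
apply: (@intr_inj algC).
have sD0 : sqrtC (Delta w0 w S)%:~R != 0 :> algC.
  by rewrite sqrtC_eq0 intr_eq0 (Delta_neq0 w0 w uniqS S_n).
apply: (mulIf sD0); rewrite mul1r -(aut_sD k (idfun : {rmorphism algC -> algC})) // => y yn1.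
by rewrite -(expr_mod _ yn1) k1 expr_mod.
Qed.

Lemma Delta_char_sqr k : coprime k n -> Delta_char w0 w S k * Delta_char w0 w S k = 1.
Proof. by move=> co_k; case/orP: (Delta_char_pm1 w0 w S_n co_k) => /eqP->. Qed.

Lemma inHE k : inH w0 w S k = (Delta_char w0 w S k == 1). Proof. by []. Qed.

Lemma notinH k : coprime k n -> ~~ inH w0 w S k -> Delta_char w0 w S k = -1.
Proof.
by move=> co_k; rewrite inHE; case/orP: (Delta_char_pm1 w0 w S_n co_k) => /eqP->.
Qed.

End DeltaCharacter.

(** * Galois symmetry of the eigenvalues of [M] *)

Section Main.

Variable gT : finGroupType.
Local Notation n := (exponent [set: gT]).
Variables (w0 w : bool) (S : seq nat) (C1 C2 : {set gT}).
Hypothesis uniqS : uniq S.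
Hypothesis S_n : forall p, p \in S -> [&& prime p, odd p & (p %| n)%N].
Hypotheses (w0_n : w0 -> (8 %| n)%N) (w_n : w -> (4 %| n)%N).
Hypotheses (nC1 : normal_set C1) (nC2 : normal_set C2).
Hypothesis disC : [disjoint C1 & C2].

Local Notation D := (Delta w0 w S).
Local Notation sD := (sqrtC D%:~R : algC).
Local Notation chi := (Delta_char w0 w S).
Local Notation M := (Amat C1 - Amat C2).

Lemma exponentT_gt0 : (0 < n)%N. Proof. exact: exponent_gt0. Qed.

Lemma normal_setJ (C : {set gT}) : normal_set C -> forall x y, (x ^ y \in C)%g = (x \in C).
Proof.
move=> nC x y; apply/idP/idP => /nC/subsetP; apply; last by rewrite memJ_class ?inE.
by rewrite class_sym memJ_class ?inE.
Qed.

Lemma simD_closed_expg (C : {set gT}) : normal_set C -> simD_closed w0 w S C <->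
  forall k, coprime k n -> chi k = 1 -> forall g, (g ^+ k \in C)%g = (g \in C).
Proof.
move=> nC; split=> [closedC k co_k Hk g|closedC g h [k [co_k Hk /imsetP[y _ ->]]]].
  by apply: closedC; exists k; rewrite co_k inHE Hk class_refl.
by rewrite normal_setJ // closedC //; apply/eqP.
Qed.

(** One function encodes both sets: as they are disjoint, its values 1 and -1 recover them. *)
Definition sgn_mem (g : gT) : int := (g \in C1)%:R - (g \in C2)%:R.

Lemma sgn_mem_class : class_fun sgn_mem.
Proof. by move=> x y; rewrite /sgn_mem !normal_setJ. Qed.

Lemma sgn_memE g : ((g \in C1) = (sgn_mem g == 1)) * ((g \in C2) = (sgn_mem g == -1)).
Proof.
rewrite /sgn_mem; case C1g: (g \in C1); last by case: (g \in C2).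
by rewrite (disjointFr disC C1g).
Qed.

Lemma cayley_sgn_mem : M = cayley_mx (fun g => (sgn_mem g)%:~R).
Proof. by apply/matrixP => a b; rewrite !mxE rmorphB /= !rmorph_nat. Qed.

Local Notation lam := (irr_eigen (fun g => (sgn_mem g)%:~R)).

Lemma eigenvalueM_P (P : algC -> Prop) :
  (forall l, eigenvalue M l -> P l) <-> (forall i, P (lam i)).
Proof.
have cf : class_fun (fun g => (sgn_mem g)%:~R : algC).
  by move=> x y; rewrite sgn_mem_class.
rewrite cayley_sgn_mem; split=> [HP i|HP l /(eigenvalue_cayley _ cf)[i ->] //].
by apply/HP/eigenvalue_cayley => //; exists i.
Qed.

Lemma sD_neq0 : sD != 0.
Proof. by rewrite sqrtC_eq0 intr_eq0 (Delta_neq0 w0 w uniqS S_n). Qed.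

Lemma chiM k l : coprime k n -> coprime l n -> chi (k * l)%N = chi k * chi l.
Proof. by apply: Delta_charM => //; apply: exponentT_gt0. Qed.

Lemma coprime_inv_exponent k : coprime k n ->
  exists k', [/\ coprime k' n, chi k' = chi k & forall g : gT, (g ^+ (k * k') = g)%g].
Proof.
move=> co_k; have [k' [co_k' k1 kk']] := expg_coprime_inv co_k.
exists k'; split=> //; have := Delta_char_mod1 exponentT_gt0 S_n uniqS w0_n w_n k1.
rewrite chiM // => ck.
by rewrite -[LHS]mul1r -(Delta_char_sqr w0 w S_n co_k) -mulrA ck mulr1.
Qed.

Lemma irr_eigen_rat (f : gT -> int) i : class_fun f ->
  (forall k, coprime k n -> forall g, f (g ^+ k)%g = f g) ->
  irr_eigen (fun g => (f g)%:~R) i \in Crat.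
Proof.
move=> f_class fk; have [z zP] := C_prim_root_exists exponentT_gt0.
apply: (in_Qz_fixed_rat zP (in_Qz_irr_eigen f i zP)) => k u co_k Du.
have [_ H] := irr_eigen_aut_sign f_class co_k Du (mul1r (1 : int)).
by rewrite H ?mul1r // => g; rewrite mul1r fk.
Qed.

(** Every automorphism multiplies the eigenvalue and [sD] by the same sign, so it fixes the
    quotient. *)
Lemma irr_eigen_sqrt (f : gT -> int) i : class_fun f ->
  (forall k, coprime k n -> forall g, f (g ^+ k)%g = chi k * f g) ->
  irr_eigen (fun g => (f g)%:~R) i / sD \in Crat.
Proof.
move=> f_class fk; have [z zP] := C_prim_root_exists exponentT_gt0.
have [in_sD aut_sD] := sqrt_Delta_Galois exponentT_gt0 S_n w0_n w_n.
have in_Q : in_Qz z (irr_eigen (fun g => (f g)%:~R) i / sD).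
  have -> : sD^-1 = sD * ratr (D%:~R)^-1.
    apply: (mulfI sD_neq0); rewrite fmorphV /= ratr_int mulrA -expr2 sqrtCK.
    by rewrite !mulfV ?sD_neq0 // intr_eq0 (Delta_neq0 w0 w uniqS S_n).
  by apply: in_QzM; [exact: in_Qz_irr_eigen|apply: in_QzM; [exact: in_sD|exact: in_Qz_rat]].
apply: (in_Qz_fixed_rat zP in_Q) => k u co_k Du.
have cc1 := Delta_char_sqr w0 w S_n co_k.
have [_ H] := irr_eigen_aut_sign f_class co_k Du cc1.
rewrite fmorph_div /= H ?(aut_sD k u) // ?invfM; last exact: fk.
have c0 : (chi k)%:~R != 0 :> algC.
  by rewrite intr_eq0; apply: contra_eqN cc1 => /eqP->; rewrite mul0r.
by rewrite mulrACA mulfV // mul1r.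
Qed.

Lemma closed_sgn_mem :
  (simD_closed w0 w S C1 /\ simD_closed w0 w S C2) <->
  (forall k, coprime k n -> chi k = 1 -> forall g, sgn_mem (g ^+ k)%g = sgn_mem g).
Proof.
split=> [[/(simD_closed_expg nC1) cl1 /(simD_closed_expg nC2) cl2] k co_k Hk g|cl].
  by rewrite /sgn_mem cl1 ?cl2.
split; [apply/(simD_closed_expg nC1)|apply/(simD_closed_expg nC2)];
  by move=> k co_k Hk g; rewrite !sgn_memE cl.
Qed.

Lemma chi_Delta1 k : D = 1 -> coprime k n -> chi k = 1.
Proof.
move=> D1 co_k; have [_ aut_sD] := sqrt_Delta_Galois exponentT_gt0 S_n w0_n w_n.
have [u Du] := Qn_aut_exists co_k.
have := aut_sD k u co_k Du; rewrite D1 rmorph1 sqrtC1 rmorph1 mulr1 => H.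
by apply: (@intr_inj algC); rewrite -H.
Qed.

Lemma quadratic_eigenvalues :
  (forall i, exists a b : rat, lam i = ratr a + ratr b * sD) <->
  (simD_closed w0 w S C1 /\ simD_closed w0 w S C2).
Proof.
have [in_sD aut_sD] := sqrt_Delta_Galois exponentT_gt0 S_n w0_n w_n.
split=> [lamP|/closed_sgn_mem cl i].
  apply/closed_sgn_mem => k co_k ck g.
  have [u Du] := Qn_aut_exists co_k.
  have [H _] := irr_eigen_aut_sign sgn_mem_class co_k Du (mul1r (1 : int)).
  rewrite H ?mul1r // => i; have [a [b ->]] := lamP i.
  by rewrite mul1r rmorphD /= fmorph_rat [u (_ * _)]rmorphM /= fmorph_rat (aut_sD k u) // ck mul1r.
have [D1|/eqP D1] := eqVneq D 1.
  have /CratP[a Da] : lam i \in Crat.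
    by apply: irr_eigen_rat => [|k co_k g]; [exact: sgn_mem_class|rewrite cl ?chi_Delta1].
  by exists a, 0; rewrite rmorph0 mul0r addr0.
have [k0 co_k0 ck0] := Delta_char_nontrivial exponentT_gt0 uniqS S_n w0_n w_n D1.
(* Since [k0 * k0] and [k * k0] both lie in the kernel of [chi], the value at [g ^+ (k * k0 * k0)]
   equals both sides. *)
have k0_sgn k g : coprime k n -> chi k = -1 -> sgn_mem (g ^+ k)%g = sgn_mem (g ^+ k0)%g.
  move=> co_k ck; rewrite -[LHS](cl (k0 * k0)%N) ?coprimeMl ?co_k0 ?chiM ?ck0 //.
  rewrite -expgM mulnCA expgM (cl (k * k0)%N) //; first by rewrite coprimeMl co_k.
  by rewrite chiM // ck ck0.
have k0k_sgn k g : coprime k n -> chi k = -1 -> sgn_mem (g ^+ k ^+ k0)%g = sgn_mem g.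
  by move=> co_k ck; rewrite -expgM cl // ?coprimeMl ?co_k ?chiM // ck ck0.
have k0H_sgn k g : coprime k n -> chi k = 1 ->
    sgn_mem (g ^+ k ^+ k0)%g = sgn_mem (g ^+ k0)%g.
  by move=> co_k ck; rewrite -expgM mulnC expgM (cl k).
(* [2 * sgn_mem = fD + fB], where the eigenvalues of [fD] lie in [Q] and those
   of [fB] in [Q * sD]. *)
pose fD g := sgn_mem g + sgn_mem (g ^+ k0)%g.
pose fB g := sgn_mem g + - sgn_mem (g ^+ k0)%g.
have fD_class : class_fun fD by move=> x y; rewrite /fD -conjXg !sgn_mem_class.
have fB_class : class_fun fB by move=> x y; rewrite /fB -conjXg !sgn_mem_class.
have /CratP[a Da] : irr_eigen (fun g => (fD g)%:~R) i \in Crat.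
  apply: irr_eigen_rat => // k co_k g; rewrite /fD.
  case/orP: (Delta_char_pm1 w0 w S_n co_k) => /eqP ck; first by rewrite cl ?k0H_sgn.
  by rewrite k0_sgn // k0k_sgn // addrC.
have /CratP[b Db] : irr_eigen (fun g => (fB g)%:~R) i / sD \in Crat.
  apply: irr_eigen_sqrt => // k co_k g; rewrite /fB.
  case/orP: (Delta_char_pm1 w0 w S_n co_k) => /eqP ck; rewrite ck.
    by rewrite mul1r cl ?k0H_sgn.
  by rewrite k0_sgn // k0k_sgn // mulN1r [RHS]opprB.
exists (a / 2), (b / 2); rewrite !fmorph_div /= -Da -Db ratr_nat.
have -> : irr_eigen (fun g => (fB g)%:~R) i / sD / 2 * sD =
    irr_eigen (fun g => (fB g)%:~R) i / 2.
  by rewrite mulrAC mulfVK ?sD_neq0.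
rewrite -mulrDl -irr_eigenD; apply: (canRL (mulfK _)); first by rewrite pnatr_eq0.
rewrite -[2]/(1 + 1) mulrDr !mulr1 -irr_eigenD /irr_eigen; congr (_ / _).
by apply: eq_bigr => g _; rewrite /fD /fB [in RHS]addrACA subrr addr0.
Qed.

(** If [k'] inverts [k], then [h] is in [C2] exactly when [h ^+ k'] is in [C1]. An exponent outside
    the kernel of [chi] becomes one inside it when multiplied by [k] or [k'], hence it exchanges the
    two sets. *)
Lemma closed_pow_sgn_mem k : coprime k n -> chi k = -1 ->
  simD_closed w0 w S C1 -> C2 = set_pow C1 k ->
  forall l, coprime l n -> forall g, sgn_mem (g ^+ l)%g = chi l * sgn_mem g.
Proof.
move=> co_k ck /(simD_closed_expg nC1) cl1 C2E l co_l g.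
have [k' [co_k' ck' kk']] := coprime_inv_exponent co_k; rewrite ck in ck'.
have C2P h : (h \in C2) = (h ^+ k' \in C1)%g.
  rewrite C2E; apply/imsetP/idP => [[x C1x ->]|C1h]; first by rewrite -expgM kk'.
  by exists (h ^+ k')%g => //; rewrite -expgM mulnC kk'.
case/orP: (Delta_char_pm1 w0 w S_n co_l) => /eqP cll; rewrite cll /sgn_mem.
  by rewrite mul1r !C2P -expgM mulnC expgM !(cl1 l).
rewrite mulN1r opprB !C2P -expgM; congr (_%:R - _%:R).
  have {1}-> : (g ^+ l = g ^+ k' ^+ (k * l))%g by rewrite -expgM mulnCA mulnA expgM kk'.
  by rewrite (cl1 (k * l)%N) ?coprimeMl ?co_k // chiM // ck cll.
by rewrite (cl1 (l * k')%N) ?coprimeMl ?co_l // chiM // ck' cll.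
Qed.

Lemma integral_eigenvalues :
  (forall i, exists z : int, lam i = z%:~R * sD) <->
  ((D = 1 /\ simD_closed w0 w S C1 /\ simD_closed w0 w S C2)
   \/ [/\ D <> 1, simD_closed w0 w S C1 &
         (exists k : nat, [/\ coprime k n, ~~ inH w0 w S k & C2 = set_pow C1 k])]).
Proof.
have [in_sD aut_sD] := sqrt_Delta_Galois exponentT_gt0 S_n w0_n w_n.
split=> [lamP|].
  have [cl1 cl2] : simD_closed w0 w S C1 /\ simD_closed w0 w S C2.
    apply/quadratic_eigenvalues => i; have [z ->] := lamP i.
    by exists 0, z%:~R; rewrite rmorph0 add0r ratr_int.
  have [D1|/eqP D1] := eqVneq D 1; first by left.
  right; split=> //.
  have [k co_k ck] := Delta_char_nontrivial exponentT_gt0 uniqS S_n w0_n w_n D1.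
  exists k; split=> //; first by rewrite inHE ck.
  have [u Du] := Qn_aut_exists co_k.
  have [/(_ _) H _] := irr_eigen_aut_sign sgn_mem_class co_k Du (Delta_char_sqr w0 w S_n co_k).
  (* This [u] negates [sD], hence all eigenvalues, so the power [k] exchanges the values 1 and -1 of
     [sgn_mem]. *)
  have {}H g : sgn_mem (g ^+ k)%g = - sgn_mem g.
    rewrite H ?ck ?mulN1r // => i; have [z ->] := lamP i.
    by rewrite rmorphM rmorph_int /= (aut_sD k u) // mulrCA ck.
  have [k' [_ _ kk']] := coprime_inv_exponent co_k.
  apply/setP => h; rewrite sgn_memE; apply/idP/imsetP => [Ch|[g C1g ->]].
    exists (h ^+ k')%g; last by rewrite -expgM mulnC kk'.
    by rewrite sgn_memE -eqr_opp -H -expgM mulnC kk'.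
  by rewrite H eqr_opp -sgn_memE.
case=> [[D1 closed]|[D1 cl1 [k [co_k Hk C2E]]]] i.
  have /quadratic_eigenvalues/(_ i)[a [b lamE]] := closed.
  (* With [D = 1] the field is Q, and a rational algebraic integer is an integer. *)
  have : lam i \in Num.int.
    apply: Cint_rat_Aint (irr_eigen_Aint _ sgn_mem_class).
    by rewrite lamE D1 rmorph1 sqrtC1 mulr1 rpredD ?Crat_rat.
  by case/intrP=> z ->; exists z; rewrite D1 rmorph1 sqrtC1 mulr1.
have ck := notinH S_n co_k Hk.
have q_rat := irr_eigen_sqrt i sgn_mem_class (closed_pow_sgn_mem co_k ck cl1 C2E).
(* The square of the rational quotient times [D] is [lam i ^+ 2], a rational algebraic integer, so
   squarefreeness of [D] applies. *)
have /intrP[z Dz] : lam i / sD \in Num.int.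
  apply: (Delta_sqr_int (w0 := w0) (w := w) uniqS S_n q_rat).
  have sq : (lam i / sD) ^+ 2 * D%:~R = lam i ^+ 2.
    rewrite exprMn exprVn sqrtCK mulfVK // intr_eq0.
    exact: (Delta_neq0 w0 w uniqS S_n).
  rewrite sq; apply: Cint_rat_Aint; last first.
    by rewrite rpredX // irr_eigen_Aint //; exact: sgn_mem_class.
  by rewrite -sq rpredM ?rpredX // rpred_int.
by exists z; rewrite -Dz mulfVK ?sD_neq0.
Qed.

(** * Complex conjugation: oriented and signed graphs *)

Lemma conj_eigenvalues (c : int) : c * c = 1 -> (sD^* = c%:~R * sD) ->
  (forall i, exists z : int, lam i = z%:~R * sD) ->
  forall g, sgn_mem g^-1%g = c * sgn_mem g.
Proof.
move=> cc1 sDc lamP g.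
(* The natural number [n.-1] stands for the exponent -1, by which conjugation acts on roots of
   unity. *)
have co_k : coprime n.-1 n by rewrite coprimePn ?exponentT_gt0.
have Du y : y ^+ n = 1 -> y^* = y ^+ n.-1 :> algC.
  move=> yn1; have y0 : y != 0.
    apply: contra_eqN yn1 => /eqP->.
    by rewrite expr0n gtn_eqF ?exponentT_gt0 // eq_sym oner_eq0.
  have ny1 : `|y| = 1.
    by apply/eqP; rewrite -(@pexpr_eq1 _ _ n) ?exponentT_gt0 // -normrX yn1 normr1.
  apply: (mulfI y0); rewrite -normCK ny1 expr1n -exprS prednK ?exponentT_gt0 //.
have [/(_ _) H _] := irr_eigen_aut_sign (u := Num.conj) sgn_mem_class co_k Du cc1.
have gV : (g ^+ n.-1 = g^-1)%g.
  apply: (mulgI g); rewrite -expgS prednK ?exponentT_gt0 // mulgV.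
  by rewrite expg_exponent ?inE.
rewrite -gV H // => i; have [z ->] := lamP i.
by rewrite rmorphM rmorph_int /= sDc mulrCA.
Qed.

(** Conjugation fixes the square [D], so it fixes or negates [sD]; a real [sD] would make [D]
    nonnegative. *)
Lemma conj_sqrt_Delta : sD^* = (if 0 < D then 1 else -1)%:~R * sD.
Proof.
have sq : (sD^*) ^+ 2 == sD ^+ 2 by rewrite -rmorphXn /= sqrtCK rmorph_int.
case: ifP => D_gt0.
  rewrite mul1r; apply/CrealP; rewrite sqrtC_real //.
  by rewrite ler0z ltW.
move: sq; rewrite eqf_sqr mulN1r => /orP[]/eqP // cj.
have : 0 <= sD ^+ 2 by rewrite real_exprn_even_ge0 //; apply/CrealP.
rewrite sqrtCK ler0z le_eqVlt D_gt0 orbF eq_sym.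
by rewrite (negbTE (Delta_neq0 w0 w uniqS S_n)).
Qed.

(** For negative [D], conjugation negates [sD], so [sgn_mem] is odd under inversion and [C2] is the
    inverse of [C1]. *)
Lemma oriented_case : (forall i, exists z : int, lam i = z%:~R * sD) -> D < 0 ->
  exists C : {set gT}, [/\ normal_set C, (C :&: C^-1)%g = set0 & M = Amat C - (Amat C)^T].
Proof.
move=> lamP D_lt0; have sDc := conj_sqrt_Delta.
rewrite ifF in sDc; last by apply/negbTE; rewrite -leNgt ltW.
have sgnV := conj_eigenvalues (erefl : -1 * -1 = 1 :> int) sDc lamP.
have C2E : C2 = C1^-1%g.
  by apply/setP => g; rewrite inE !sgn_memE sgnV mulN1r eqr_oppLR.
exists C1; split=> //; first by apply: disjoint_setI0; rewrite -C2E.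
apply/matrixP => a b; rewrite !mxE C2E; congr (_ - _%:R).
by rewrite inE invMg invgK.
Qed.

Lemma signed_case : (forall i, exists z : int, lam i = z%:~R * sD) -> 0 < D ->
  C1^-1%g = C1 /\ C2^-1%g = C2.
Proof.
move=> lamP D_gt0; have sDc := conj_sqrt_Delta; rewrite D_gt0 in sDc.
have sgnV := conj_eigenvalues (erefl : 1 * 1 = 1 :> int) sDc lamP.
by split; apply/setP => g; rewrite inE !sgn_memE sgnV mul1r.
Qed.

End Main.

Theorem theorem9p2 (gT : finGroupType) (w0 w : bool) (S : seq nat)
  (C1 C2 : {set gT}) :
  let n1 := exponent [set: gT] in
  let D := Delta w0 w S in
  let sD : algC := sqrtC (D%:~R) in
  let M := Amat C1 - Amat C2 in
  uniq S ->
  (forall p, p \in S -> [&& prime p, odd p & (p %| n1)%N]) ->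
  (w0 -> (8 %| n1)%N) ->
  (w -> (4 %| n1)%N) ->
  normal_set C1 -> normal_set C2 -> [disjoint C1 & C2] ->
  (1 \notin C1 :|: C2)%g ->
  [/\
   (* (i) *)
   (forall l : algC, eigenvalue M l -> exists a b : rat, l = ratr a + ratr b * sD)
     <-> (simD_closed w0 w S C1 /\ simD_closed w0 w S C2),
   (* (ii) *)
   (forall l : algC, eigenvalue M l -> exists z : int, l = z%:~R * sD)
     <-> ((D = 1 /\ simD_closed w0 w S C1 /\ simD_closed w0 w S C2)
          \/ [/\ D <> 1, simD_closed w0 w S C1 &
                 (exists k : nat, [/\ coprime k n1, ~~ inH w0 w S k &
                                     C2 = set_pow C1 k])]),
   (* oriented case *)
   ((forall l : algC, eigenvalue M l -> exists z : int, l = z%:~R * sD) ->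
      D < 0 ->
      exists C : {set gT}, [/\ normal_set C, (C :&: C^-1)%g = set0 &
                               M = Amat C - (Amat C)^T]) &
   (* signed case *)
   ((forall l : algC, eigenvalue M l -> exists z : int, l = z%:~R * sD) ->
      D <> 1 -> D > 0 ->
      exists Cp Cm : {set gT},
        [/\ normal_set Cp /\ normal_set Cm, [disjoint Cp & Cm],
            (Cp^-1)%g = Cp /\ (Cm^-1)%g = Cm, (1 \notin Cp :|: Cm)%g &
            M = Amat Cp - Amat Cm])].
Proof.
move=> n1 D sD M uniqS S_n w0_n w_n nC1 nC2 disC notC1.
have eigP := eigenvalueM_P nC1 nC2; split.
- by apply: iff_trans (eigP _) _; apply: quadratic_eigenvalues.
- by apply: iff_trans (eigP _) _; apply: integral_eigenvalues.
- by move=> /eigP; apply: oriented_case.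
move=> /eigP lamP _ D_gt0; exists C1, C2; split=> //.
exact: signed_case lamP D_gt0.
Qed.
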